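(* Let $\Omega\subseteq\mathbb{R}^n$ be closed and convex, let $f$ be a real-valued continuously differentiable function on $\Omega$, let $S\subseteq\mathbb{R}^q$, let $\sigma\in S$, and let $h_\sigma\in\mathcal{H}(f,\Omega,S)$ be a metric function associated to $f$. A point $x\in\Omega$ is a stationary point of the problem $\min_{x\in\Omega}f(x)$ if and only if $x=p(x;h_\sigma)$, where $p(x;h_\sigma)=\arg\min_{z\in\Omega}h_\sigma(z,x)$.
   Context: Stationarity: $x\in\Omega$ is a stationary point of $\min_{x\in\Omega}f(x)$ if $\nabla f(x)^T(y-x)\ge 0$ for all $y\in\Omega$. Metric function: let $S\subseteq\mathbb{R}^q$ be a set of parameters. A metric function associated to $f$ is any continuously differentiable function $h_\sigma:\Omega\times\Omega\to\mathbb{R}$ such that for any choice of the parameter $\sigma\in S$ the following hold ($\nabla_1$ denotes the gradient with respect to the first argument): (H1) $h_\sigma$ is convex with respect to its first argument, i.e. $h_\sigma(y,z)\ge h_\sigma(x,z)+\nabla_1 h_\sigma(x,z)^T(y-x)$ for all $x,y,z\in\Omega$, and for any $z\in\Omega$ the function $h_\sigma(\cdot,z)$ admits a unique minimum point (on $\Omega$); (H2) for any $x\in\Omega$ and any feasible direction $d\in\mathbb{R}^n$ at $x$ (i.e. $x+td\in\Omega$ for all sufficiently small $t>0$), $\nabla_1 h_\sigma(x,x)^T d=\nabla f(x)^T d$; (H3) $h_\sigma$ continuously depends on the parameter $\sigma$. The set of such metric functions is denoted $\mathcal{H}(f,\Omega,S)$. For $h_\sigma\in\mathcal{H}(f,\Omega,S)$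 the associated generalized gradient projection operator $p(\,\cdot\,;h_\sigma):\Omega\to\Omega$ is $p(x;h_\sigma)=\arg\min_{z\in\Omega}h_\sigma(z,x)$. *)

(* Defs.v *)
From HB Require Import structures.
From mathcomp Require Import all_boot all_order all_algebra.
From mathcomp Require Import all_classical all_reals all_analysis.

Set Implicit Arguments.
Unset Strict Implicit.
Unset Printing Implicit Defensive.

Import Order.TTheory GRing.Theory Num.Theory.
Import numFieldNormedType.Exports.

Local Open Scope classical_set_scope.
Local Open Scope ring_scope.

Section Definitions.
Context {R : realType}.

Definition dot {m} (u v : 'cV[R]_m) : R := (u^T *m v) 0 0.

(* [g] is a gradient at [x] of [f] regarded as a function on [A] only: the
   increments of [f] are taken within [A], and the values of [f] outside [A]
   are irrelevant. When [x] is interior to [A], [g] is the usual gradient. *)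
Definition is_gradient {m} (A : set 'cV[R]_m) (f : 'cV[R]_m -> R)
    (x g : 'cV[R]_m) : Prop :=
  (fun y => f y - f x - dot g (y - x)) =o_ (within A (nbhs x))
    (fun y => y - x).

(* If the directions into [A] at [x] do not span the space, then [is_gradient]
   does not determine [g], and [gradient] makes a choice. The product
   [dot (gradient A f x) d] does not depend on that choice when [d] is a
   feasible direction of [A] at [x] (lemma [dot_is_gradient_unique] below), and
   for such [d] it agrees with the ordinary gradient when [f] is differentiable
   at [x] (lemma [differentiable_is_gradient] below). *)
Definition gradient {m} (A : set 'cV[R]_m) (f : 'cV[R]_m -> R)
    (x : 'cV[R]_m) : 'cV[R]_m :=
  xget 0 (is_gradient A f x).

Definition continuously_differentiable {m} (A : set 'cV[R]_m)
    (f : 'cV[R]_m -> R) : Prop :=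
  exists g : 'cV[R]_m -> 'cV[R]_m,
    {within A, continuous g} /\ forall x, A x -> is_gradient A f x (g x).

Definition feasible_direction {n} (Omega : set 'cV[R]_n) (x d : 'cV[R]_n) :=
  \forall t \near 0^'+, Omega (x + t *: d).

Definition stationary {n} (Omega : set 'cV[R]_n) (f : 'cV[R]_n -> R)
    (x : 'cV[R]_n) : Prop :=
  Omega x /\ forall y, Omega y -> 0 <= dot (gradient Omega f x) (y - x).

Definition minimizers {n} (Omega : set 'cV[R]_n) (g : 'cV[R]_n -> R) :
    set 'cV[R]_n :=
  [set z | Omega z /\ forall y, Omega y -> g z <= g y].

Definition gradient1 {n} (Omega : set 'cV[R]_n)
    (h : 'cV[R]_n -> 'cV[R]_n -> R) (x z : 'cV[R]_n) : 'cV[R]_n :=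
  gradient Omega (h^~ z) x.

(* R^n x R^n is identified with R^(n + n) by stacking the two arguments. *)
Definition continuously_differentiable2 {n} (Omega : set 'cV[R]_n)
    (h : 'cV[R]_n -> 'cV[R]_n -> R) : Prop :=
  continuously_differentiable
    [set w : 'cV[R]_(n + n) | Omega (usubmx w) /\ Omega (dsubmx w)]
    (fun w => h (usubmx w) (dsubmx w)).

Record metric_function {n q} (f : 'cV[R]_n -> R) (Omega : set 'cV[R]_n)
    (S : set 'cV[R]_q) (h : 'cV[R]_q -> 'cV[R]_n -> 'cV[R]_n -> R) : Prop :=
  MetricFunction {
    metric_C1 : forall sigma, S sigma ->
      continuously_differentiable2 Omega (h sigma);
    metric_convex : forall sigma, S sigma ->
      forall x y z, Omega x -> Omega y -> Omega z ->
      h sigma y z >= h sigma x z + dot (gradient1 Omega (h sigma) x z) (y - x);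
    metric_unique_min : forall sigma, S sigma ->
      forall z, Omega z -> exists! x, minimizers Omega ((h sigma)^~ z) x;
    metric_gradient : forall sigma, S sigma ->
      forall x d, Omega x -> feasible_direction Omega x d ->
      dot (gradient1 Omega (h sigma) x x) d = dot (gradient Omega f x) d;
    metric_parameter : forall x z, Omega x -> Omega z ->
      {within S, continuous (fun sigma => h sigma x z)} }.

(* The default value [0] of [xget] is immaterial for a metric function, as the
   minimizer exists and is unique. *)
Definition projection {n} (Omega : set 'cV[R]_n)
    (h : 'cV[R]_n -> 'cV[R]_n -> R) (x : 'cV[R]_n) : 'cV[R]_n :=
  xget 0 (minimizers Omega (h^~ x)).

Lemma dot_is_gradient_unique {m} (A : set 'cV[R]_m) (f : 'cV[R]_m -> R)
    (x g1 g2 d : 'cV[R]_m) :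
  is_gradient A f x g1 -> is_gradient A f x g2 ->
  feasible_direction A x d -> dot g1 d = dot g2 d.
Proof.
move=> /eqoP G1 /eqoP G2 fd; apply/eqP; rewrite -subr_eq0 -normr_le0.
apply/ler_addgt0Pr => e e0; rewrite add0r.
have c0 : 0 < `|d| + 1 by rewrite ltr_wpDl.
have e'0 : 0 < e / 2 / (`|d| + 1) by rewrite !divr_gt0.
have cvt : x + t *: d @[t --> 0^'+] --> x.
  have : x + t *: d @[t --> 0^'+] --> x + 0 *: d.
    apply: cvgD; first exact: cvg_cst.
    by apply: cvgZr_tmp; apply: cvg_at_right_filter; exact: cvg_id.
  by rewrite scale0r addr0.
have L g : (forall eps, 0 < eps -> \forall y \near within A (nbhs x),
      `|f y - f x - dot g (y - x)| <= eps * `|y - x|) ->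
    \forall t \near 0^'+, `|f (x + t *: d) - f x - t * dot g d| <= t * (e / 2).
  move=> /(_ _ e'0); rewrite near_withinE => /cvt H.
  near=> t.
  have t0 : 0 < t by near: t; exact: nbhs_right_gt.
  have At : A (x + t *: d) by near: t.
  have /(_ At) : A (x + t *: d) ->
      `|f (x + t *: d) - f x - dot g (x + t *: d - x)|
        <= e / 2 / (`|d| + 1) * `|x + t *: d - x|.
    by near: t; exact: H.
  rewrite (addrC x) addrK /dot -scalemxAr mxE normrZ (gtr0_norm t0).
  move=> /le_trans; apply; rewrite mulrCA ler_pM2l// mulrAC ler_pdivrMr//.
  by rewrite ler_pM2l ?divr_gt0// lerDl.
have [t [t0]] : exists t, 0 < t /\
    (`|f (x + t *: d) - f x - t * dot g1 d| <= t * (e / 2) /\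
     `|f (x + t *: d) - f x - t * dot g2 d| <= t * (e / 2)).
  near (0 : R)^'+ => t; exists t; split; last split.
  - by near: t; exact: nbhs_right_gt.
  - by near: t; exact: L G1.
  - by near: t; exact: L G2.
move=> [H1 H2]; rewrite -(ler_pM2l t0) -[t in t * `|_|](gtr0_norm t0) -normrM.
rewrite mulrBr [e]splitr mulrDr.
have -> : t * dot g1 d - t * dot g2 d = (f (x + t *: d) - f x - t * dot g2 d) -
   (f (x + t *: d) - f x - t * dot g1 d) by rewrite opprB [RHS]addrC subrKA.
by apply: (le_trans (ler_normB _ _)); rewrite lerD.
Unshelve. all: by end_near.
Qed.

Lemma differentiable_is_gradient {m} (A : set 'cV[R]_m)
    (f : 'cV[R]_m -> R) (x : 'cV[R]_m) :
  differentiable f x ->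
  is_gradient A f x (\col_i 'D_(delta_mx i 0) f x).
Proof.
move=> df; apply/eqoP => e e0; rewrite near_withinE.
have /eqaddoP /(_ _ e0) H := diff_locally df.
have {}H : \forall y \near x,
    `|(f \o shift x - (cst (f x) + 'd f x)) (y - x)| <= e * `|y - x|.
  have c : y - x @[y --> x] --> (0 : 'cV[R]_m).
    have := @cvgB _ _ _ (nbhs x) _ id (cst x) x x cvg_id (cvg_cst x).
    rewrite subrr; exact.
  exact: (c _ H).
apply: filterS H => y + _.
suff -> : dot (\col_i 'D_(delta_mx i 0) f x) (y - x) = 'd f x (y - x).
  by rewrite !fctE /= subrK opprD addrA; apply.
rewrite {2}[y-x]matrix_sum_delta linear_sum /= /dot mxE; apply: eq_bigr => i _.
by rewrite big_ord1 linearZ /= !mxE deriveE// mulrC.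
Qed.

End Definitions.

(* Main.v *)
(* By (H1), h(.,x) is convex with gradient grad f(x) at x along feasible
   directions (H2), so stationarity of x for f is the first-order optimality
   condition for x to minimize h(.,x), which is sufficient by convexity. By
   uniqueness of the minimizer this means x = p(x; h). *)
Require Import Defs.
From mathcomp Require Import all_boot all_order all_algebra.
From mathcomp Require Import all_classical all_reals all_analysis.
Import Order.TTheory GRing.Theory Num.Theory.
Import numFieldNormedType.Exports.
Local Open Scope classical_set_scope.
Local Open Scope ring_scope.

Lemma norm_col_mx0 {R : realType} {m n : nat} (u : 'cV[R]_m) :
  `|col_mx u (0 : 'cV[R]_n)| <= `|u|.
Proof.
rewrite [leLHS]/Num.Def.normr/= mx_normrE; apply: bigmax_le => //= -[i j] _ /=.
rewrite mxE; case: splitP => k _; last by rewrite mxE normr0.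
rewrite [leRHS]/Num.Def.normr/= mx_normrE; apply/bigmax_geP.
by right; exists (k, j).
Qed.

(** Moving only the first argument gives increments [col_mx (y - x) 0]. They stay in the product set
    because [B z] holds, they are no longer than [y - x], and their zero block cancels the lower
    half of [g]. *)
Lemma is_gradient_partial1 {R : realType} {m n : nat} (A : set 'cV[R]_m)
    (B : set 'cV[R]_n) (F : 'cV[R]_m -> 'cV[R]_n -> R) (x : 'cV[R]_m)
    (z : 'cV[R]_n) (g : 'cV[R]_(m + n)) :
  B z ->
  is_gradient [set w | A (usubmx w) /\ B (dsubmx w)]
    (fun w => F (usubmx w) (dsubmx w)) (col_mx x z) g ->
  is_gradient A (F^~ z) x (usubmx g).
Proof.
move=> Bz /eqoP G; apply/eqoP => e e0; have := G _ e0.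
rewrite !near_withinE => /nbhs_ballP[r /= r0 H].
apply/nbhs_ballP; exists r => //= y xy Ay.
have colB : col_mx y z - col_mx x z = col_mx (y - x) 0.
  by rewrite opp_col_mx add_col_mx subrr.
have /H : ball (col_mx x z) r (col_mx y z).
  move: xy; rewrite -!ball_normE /= => xy.
  rewrite opp_col_mx add_col_mx subrr; exact: le_lt_trans (norm_col_mx0 _) xy.
rewrite /= !col_mxKu !col_mxKd colB => /(_ (conj Ay Bz)).
rewrite -{1}(vsubmxK g) /dot tr_col_mx mul_row_col mulmx0 addr0 => /le_trans.
by apply; rewrite ler_pM2l ?norm_col_mx0.
Qed.

(** First-order necessary condition: increments of [f] from a minimizer are nonnegative, so the
    slope along a feasible ray cannot be negative. *)
Lemma minimizers_is_gradient_ge0 {R : realType} {n : nat} (A : set 'cV[R]_n)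
    (f : 'cV[R]_n -> R) (x g d : 'cV[R]_n) :
  minimizers A f x -> is_gradient A f x g -> feasible_direction A x d ->
  0 <= dot g d.
Proof.
move=> [_ fx] /eqoP G fd; apply/ler_addgt0Pr => e e0.
have c0 : 0 < `|d| + 1 by rewrite ltr_wpDl.
(* With this tolerance the error at [x + t *: d] is at most [t * e]; the added 1 covers [d = 0]. *)
have e'0 : 0 < e / (`|d| + 1) by rewrite divr_gt0.
have cvt : x + t *: d @[t --> 0^'+] --> x.
  rewrite -[X in _ --> X]addr0 -(scale0r d).
  apply: cvgD; first exact: cvg_cst.
  by apply: cvgZr_tmp; apply: cvg_at_right_filter; exact: cvg_id.
have := G _ e'0; rewrite near_withinE => /cvt H.
near (0 : R)^'+ => t.
have t0 : 0 < t by near: t; exact: nbhs_right_gt.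
have At : A (x + t *: d) by near: t.
have /(_ At) : A (x + t *: d) ->
    `|f (x + t *: d) - f x - dot g (x + t *: d - x)|
      <= e / (`|d| + 1) * `|x + t *: d - x|.
  by near: t; exact: H.
rewrite (addrC x) addrK {1}/dot -scalemxAr mxE -/(dot g d) => /ler_normlW.
rewrite normrZ (gtr0_norm t0) lerBlDr => fH.
rewrite -(pmulr_rge0 _ t0) mulrDr addrC.
have : 0 <= f (t *: d + x) - f x by rewrite subr_ge0 fx// addrC.
move=> /le_trans; apply; apply: (le_trans fH); rewrite lerD2r.
rewrite mulrCA ler_pM2l// mulrAC ler_pdivrMr//.
by rewrite ler_pM2l// lerDl.
Unshelve. all: by end_near.
Qed.

Lemma convex_feasible_direction {R : realType} {n : nat} (A : set 'cV[R]_n)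
    (x y : 'cV[R]_n) :
  convex_set A -> A x -> A y -> feasible_direction A x (y - x).
Proof.
move=> cA Ax Ay; rewrite /feasible_direction.
near=> t.
have t0 : 0 <= t by near: t; exact: nbhs_right_ge.
have t1 : t <= 1 by near: t; exact: nbhs_right_le.
(* [y] comes first because [conv] puts the weight [t] on its first point. *)
have := cA y x (Itv01 t0 t1); rewrite !inE => /(_ Ay Ax).
suff -> : conv (Itv01 t0 t1) (y : convex_lmodType 'cV[R]_n) x
    = x + t *: (y - x) by [].
rewrite /conv /= scalerBl scale1r scalerBr addrCA.
Unshelve. all: by end_near.
Qed.

(** Existence keeps [xget] from returning its default [0]; uniqueness identifies its choice with any
    given minimizer. *)
Lemma eq_xget_minimizers {R : realType} {n : nat} (A : set 'cV[R]_n)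
    (g : 'cV[R]_n -> R) (x : 'cV[R]_n) :
  (exists! z, minimizers A g z) ->
  x = xget 0 (minimizers A g) <-> minimizers A g x.
Proof.
move=> [z [mz uz]]; split=> [->|mx]; first exact: xgetI mz.
by rewrite -(uz _ mx); exact: uz (xgetI 0 mz).
Qed.

Theorem proposition2 (R : realType) (n q : nat) (Omega : set 'cV[R]_n)
    (f : 'cV[R]_n -> R) (S : set 'cV[R]_q) (sigma : 'cV[R]_q)
    (h : 'cV[R]_q -> 'cV[R]_n -> 'cV[R]_n -> R) :
  closed Omega -> convex_set Omega ->
  continuously_differentiable Omega f ->
  S sigma ->
  metric_function f Omega S h ->
  forall x : 'cV[R]_n, Omega x ->
    (stationary Omega f x <-> x = projection Omega (h sigma) x).
Proof.
move=> _ cvxO _ Ss [C1 hcvx hmin hgrad _] x Ox.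
have gradE y : Omega y -> dot (gradient1 Omega (h sigma) x x) (y - x) =
    dot (gradient Omega f x) (y - x).
  by move=> Oy; apply: hgrad => //; exact: convex_feasible_direction.
rewrite /projection eq_xget_minimizers; last exact: hmin.
split=> [[_ st]|mx].
  (* Sufficiency: the convexity inequality based at [x] bounds [h sigma y x] from below. *)
  split=> // y Oy; apply: le_trans (hcvx _ Ss x y x Ox Oy Ox).
  by rewrite gradE// lerDl st.
split=> // y Oy; rewrite -gradE//.
apply: (minimizers_is_gradient_ge0 Omega (h sigma ^~ x) x) => //; last first.
  exact: convex_feasible_direction.
(* [gradient1] is a choice by [xget], so some gradient of [h sigma ^~ x] at [x] must be exhibited:
   the upper block of the joint gradient at [(x, x)]. *)
have [G [_ /(_ (col_mx x x)) /=]] := C1 _ Ss.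
rewrite col_mxKu col_mxKd => /(_ (conj Ox Ox)) Gx.
exact: (xgetI 0 (is_gradient_partial1 _ _ (h sigma) _ _ _ Ox Gx)).
Qed.
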